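(* Let $A_n(x)=\sum_{\pi\in S_n(321)}x^{f(\pi)}$. Then for every $n\ge0$, $A_n(x)$ equals the coefficient of $t^n$ in the Maclaurin expansion with respect to $t$ of $$\frac{1-x+\psi(t)}{2-x+t(x-1)^2},\qquad \psi(t)=\frac{1-\sqrt{1-4t}}{2t}=\sum_{m\ge0}C_mt^m.$$
   Context: $S_n(321)$ is the set of permutations $\pi=\pi_1\cdots\pi_n$ of $\{1,\dots,n\}$ with no indices $i<j<l$ such that $\pi_i>\pi_j>\pi_l$; $f(\pi)$ is the number of fixed points of $\pi$ (indices $i$ with $\pi_i=i$). $C_m=\frac{1}{m+1}\binom{2m}{m}$ is the $m$-th Catalan number. *)

(* Defs.v *)
From mathcomp Require Import all_boot all_order all_fingroup all_algebra.
From mathcomp Require Import all_classical all_reals all_analysis.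
From mathcomp Require Import lra.

Set Implicit Arguments.
Unset Strict Implicit.
Unset Printing Implicit Defensive.

Import Order.TTheory GRing.Theory Num.Theory numFieldNormedType.Exports.
Local Open Scope classical_set_scope.
Local Open Scope ring_scope.

Definition avoids321 (n : nat) (s : 'S_n) : bool :=
  [forall i : 'I_n, forall j : 'I_n, forall l : 'I_n,
    ~~ [&& (i < j)%N, (j < l)%N, (s j < s i)%N & (s l < s j)%N]].

Definition fixed_points (n : nat) (s : 'S_n) : nat := #|[set i | s i == i]%SET|.

Definition A (R : realType) (n : nat) : {poly R} :=
  \sum_(s : 'S_n | avoids321 s) 'X^(fixed_points s).

Definition catalan (R : realType) (m : nat) : R :=
  (m.+1)%:R^-1 * 'C(2 * m, m)%N%:R.

Definition psi (R : realType) (t : R) : R :=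
  (1 - Num.sqrt (1 - 4 * t)) / (2 * t).

Definition gf (R : realType) (x t : R) : R :=
  (1 - x + psi t) / (2 - x + t * (x - 1) ^+ 2).

(* [a] is the sequence of Maclaurin coefficients of [f].  The point 0 is left
   out because [psi] (and [gf 2], whose denominator is then [t]) is given by a
   formula with a removable singularity there; by [maclaurin_unique] below the
   coefficients are nevertheless all determined by [f]. *)
Definition maclaurin (R : realType) (f : R -> R) (a : nat -> R) : Prop :=
  exists2 r : R, 0 < r &
    forall t : R, 0 < `|t| < r -> pseries a t @ \oo --> f t.

Lemma maclaurin0 (R : realType) (c : nat -> R) :
  maclaurin (fun=> 0) c -> c 0%N = 0.
Proof.
case=> r r0 cvgc; pose s := r / 4; have s0 : 0 < s by rewrite /s; lra.
have Cn : cvgn (pseries (fun i => `|c i|) s).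
  apply: (@is_cvg_pseries_inside_norm _ _ (r / 2)).
    by apply/cvg_ex; exists 0; apply: cvgc; rewrite gtr0_norm; lra.
  by rewrite !gtr0_norm /s; lra.
set L := limn (pseries (fun i => `|c i|) s).
have L0 : 0 <= L.
  apply: limr_ge => //; near=> n; rewrite /pseries /series /=.
  by apply: sumr_ge0 => i _; rewrite mulr_ge0 ?exprn_ge0 ?(ltW s0).
have PL n : pseries (fun i => `|c i|) s n <= L.
  apply: nondecreasing_cvgn_le => //; apply/nondecreasing_seqP => k.
  by rewrite /pseries /series /= big_nat_recr //= lerDl mulr_ge0 ?exprn_ge0 ?(ltW s0).
have bound e : 0 < e < 1 -> `|c 0%N| <= e * L.
  case/andP=> e0 e1.
  have est : 0 < e * s by rewrite mulr_gt0.
  have ess : e * s < r by apply: (@lt_le_trans _ _ s); rewrite ?gtr_pMl //; rewrite /s; lra.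
  have /(cvgB (cvg_cst (c 0%N))) : pseries c (e * s) @ \oo --> (0 : R).
    by apply: cvgc; rewrite gtr0_norm ?est.
  rewrite subr0 => /cvg_norm H.
  rewrite -(cvg_lim _ H) //; apply: limr_le; first by apply/cvg_ex; eexists; exact: H.
  near=> n.
  have n0 : (0 < n)%N by near: n; exists 1%N.
  apply: (le_trans _ (ler_wpM2l (ltW e0) (PL n))).
  rewrite /pseries /series /= distrC big_ltn // expr0 mulr1 addrAC subrr add0r.
  rewrite (big_ltn n0) mulrDr mulr_sumr.
  apply: ler_wpDl; first by rewrite !mulr_ge0 ?exprn_ge0 ?(ltW s0) ?(ltW e0).
  apply: (le_trans (ler_norm_sum _ _ _)); rewrite !big_nat.
  apply: ler_sum => i /andP[i1 _].
  rewrite exprMn mulrCA !normrM (ger0_norm (exprn_ge0 _ (ltW s0))).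
  rewrite (ger0_norm (exprn_ge0 _ (ltW e0))).
  apply: ler_wpM2r; first by rewrite mulr_ge0 ?exprn_ge0 ?(ltW s0).
  by apply: ler_iXnr; rewrite ?(ltW e0) ?(ltW e1).
apply/eqP; rewrite -normr_le0; apply/ler_addgt0Pr => d d0; rewrite add0r.
pose e := d / (L + d + 1).
have D0 : 0 < L + d + 1 by lra.
have e01 : 0 < e < 1 by rewrite divr_gt0 //= ltr_pdivrMr //; lra.
apply: (le_trans (bound e e01)).
rewrite /e mulrAC ler_pdivrMr // ler_wpM2l; lra.
Unshelve. all: by end_near. Qed.

Lemma maclaurin_unique (R : realType) (f : R -> R) (a b : nat -> R) :
  maclaurin f a -> maclaurin f b -> a =1 b.
Proof.
move=> [r r0 Ha] [q q0 Hb].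
have main (c : nat -> R) : maclaurin (fun=> 0) c -> forall n, c n = 0.
  move=> + n; elim: n c => [|n IHn] c Hc; first exact: maclaurin0.
  apply: (IHn (fun i => c i.+1)); have c0 := maclaurin0 Hc.
  case: Hc => p p0 Hc; exists p => // t tp.
  have t0 : t != 0 by rewrite -normr_gt0; case/andP: tp.
  have := Hc t tp; rewrite -cvg_shiftS => /(@cvgMl_tmp _ _ _ _ _ t^-1); rewrite mulr0.
  apply: cvg_trans; apply: near_eq_cvg; near=> k.
  rewrite /pseries /series /= big_nat_recl // c0 mul0r add0r mulr_sumr.
  by apply: eq_bigr => i _; rewrite exprS mulrCA mulKf.
suff Hc : maclaurin (fun=> 0) (fun n => a n - b n).
  by move=> n; apply/eqP; rewrite -subr_eq0; apply/eqP; exact: main Hc n.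
exists (Num.min r q); first by rewrite lt_min r0.
move=> t /andP[t0]; rewrite lt_min => /andP[tr tq].
have := cvgB (Ha t _) (Hb t _); rewrite t0 tr tq subrr.
move=> /(_ _ isT isT).
apply: cvg_trans; apply: near_eq_cvg; near=> k.
rewrite /pseries /series /= fctE -sumrB.
by apply: eq_bigr => i _; rewrite mulrBl.
Unshelve. all: by end_near. Qed.

(* Main.v *)
(* Deleting the first letter of a 321-avoiding permutation gives a generating
   tree.  Let F(n,k) be the sum of x^#{fixed points >= k} over the 321-avoiding
   permutations of {0..n-1} whose values below k occur in increasing order, so
   that F(n,0) = A_n(x); the tree turns into the linear recursion
     F(n+1,k+1) = F(n,k) + F(n+1,k+2),   F(n+1,0) = (x-1) F(n,0) + F(n+1,1).
   For x = 1 its solution consists of the ballot numbers, with F(n,0) = C_n.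
   If v = 1 + t v^2, the row sums E_n = sum_k F(n,k) v^k satisfy
     (v-1) E_(n+1) = v^2 E_n - F(n+1,0) + (x-1) v F(n,0);
   multiplied by t^(n+1) this telescopes and expresses the partial sums of
   sum_n F(n,0) t^n exactly, up to an error tending to 0 for small t.  Hence
   that series is v / (1 - (x-1) t v) with v = psi(t), which equals gf x t. *)
Require Import Defs.
From mathcomp Require Import all_boot all_order all_algebra.
From mathcomp Require Import all_classical all_reals all_analysis.
From mathcomp Require Import perm ring lra zify.

Set Implicit Arguments.
Unset Strict Implicit.
Unset Printing Implicit Defensive.

Import Order.TTheory GRing.Theory Num.Theory numFieldNormedType.Exports.
Local Open Scope classical_set_scope.
Local Open Scope ring_scope.

(** * Arrays obeying a ballot recursion *)

Definition is_ballot (R : pzRingType) (y : R) (F : nat -> nat -> R) : Prop :=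
  [/\ F 0%N 0%N = 1,
      forall n k, (n < k)%N -> F n k = 0,
      forall n, F n.+1 0%N = y * F n 0%N + F n.+1 1%N &
      forall n k, F n.+1 k.+1 = F n k + F n.+1 k.+2].

(** The weight [2 ^- k] absorbs the recursion: the step inside a row needs [K >= 4], the boundary
    column [K >= 2|y|]. Within a row, induction descends from the zeros beyond the diagonal. *)
Lemma is_ballot_bound (R : realFieldType) (y : R) F n k :
  is_ballot y F -> `|F n k| <= (4 + 2 * `|y|) ^+ n / 2 ^+ k.
Proof.
case=> F00 Fgt F0 FS; set K := 4 + 2 * `|y|.
have y0 := normr_ge0 y.
have Kge : 4 <= K by rewrite /K; lra.
have K0 m : 0 <= K ^+ m by rewrite exprn_ge0 //; lra.
have P2 m : 0 < 2 ^- m :> R by rewrite invr_gt0 exprn_gt0.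
elim: n k => [[|k]|n IHn k].
- by rewrite F00 normr1 !expr0 divr1.
- by rewrite Fgt // normr0 divr_ge0 ?K0 // exprn_ge0.
have [m] := ubnP (n.+2 - k); elim: m k => // m IHm k; rewrite ltnS => km.
have [nk|kn] := ltnP n.+1 k.
  by rewrite Fgt // normr0 divr_ge0 ?K0 // exprn_ge0.
have {}IHm : `|F n.+1 k.+1| <= K ^+ n.+1 / 2 ^+ k.+1 by apply: IHm; lia.
case: k km kn IHm => [|k] km kn IHm.
  rewrite F0 (le_trans (ler_normD _ _)) // normrM.
  have := IHn 0%N; rewrite !expr0 !divr1 => /(ler_wpM2l y0) IHn0.
  move: IHm; rewrite expr1 !exprS => IHm.
  by have := K0 n; rewrite /K in IHm IHn0 *; nra.
rewrite FS (le_trans (ler_normD _ _)) //.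
have P0 : 0 <= K ^+ n / 2 ^+ k by rewrite mulr_ge0 ?K0 // ltW.
move: (IHn k) IHm (ler_wpM2r P0 Kge); rewrite !exprS !invfM.
move: (K ^+ n) (2 ^- k) => p q; nra.
Qed.

Lemma is_ballot_rowsum (R : comPzRingType) (y v : R) F n : is_ballot y F ->
  (v - 1) * (\sum_(k < n.+2) F n.+1 k * v ^+ k) =
  v ^+ 2 * (\sum_(k < n.+1) F n k * v ^+ k) - F n.+1 0%N + v * y * F n 0%N.
Proof.
case=> F00 Fgt F0 FS; rewrite mulrBl mul1r [X in _ - X]big_ord_recl /=.
rewrite mulr_sumr big_ord_recl /= mulr_sumr expr0 !mulr1 F0.
have -> : \sum_(i < n.+1) v * (F n.+1 (bump 0 i) * v ^+ bump 0 i) =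
  \sum_(i < n.+1) (v ^+ 2 * (F n i * v ^+ i) + v * (F n.+1 i.+2 * v ^+ i.+1)).
  by apply: eq_bigr => i _; rewrite /bump add1n FS !exprS; ring.
rewrite big_split /=.
have -> : \sum_(i < n.+1) F n.+1 (bump 0 i) * v ^+ bump 0 i =
    F n.+1 1%N * v + \sum_(i < n.+1) v * (F n.+1 i.+2 * v ^+ i.+1).
  rewrite big_ord_recl /= /bump add1n expr1; congr (_ + _).
  (* The extra last term contains [F n.+1 n.+2], which lies beyond the diagonal; hence the two tails
     cancel. *)
  rewrite [RHS]big_ord_recr /= Fgt // mul0r mulr0 addr0.
  by apply: eq_bigr => i _; rewrite !add1n exprS; ring.
ring.
Qed.

(** Under [v - 1 = t * v ^+ 2] the left side of [is_ballot_rowsum] is t v^2 E_(n+1), so times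
    t^(n+1) it relates consecutive remainders. *)
Lemma is_ballot_partial_sum (R : comPzRingType) (y t v : R) F n :
  is_ballot y F -> v - 1 = t * v ^+ 2 ->
  (1 - y * v * t) * (\sum_(0 <= i < n) F i 0%N * t ^+ i) =
  v - F n 0%N * t ^+ n - v ^+ 2 * t ^+ n.+1 * (\sum_(k < n.+1) F n k * v ^+ k).
Proof.
move=> Fb vt; elim: n => [|n IHn].
  case: Fb => F00 _ _ _.
  by rewrite big_geq // big_ord1 /= F00; ring: (esym vt).
rewrite big_nat_recr //= mulrDr IHn.
have := is_ballot_rowsum v n Fb.
set E := \sum_(k < n.+2) _; set E' := \sum_(k < n.+1) _.
rewrite vt => H.
have -> : v ^+ 2 * t ^+ n.+2 * E = t ^+ n.+1 * (t * v ^+ 2 * E) by rewrite !exprS; ring.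
by rewrite H !exprS; ring.
Qed.

(** * Ballot numbers and Catalan numbers *)

(* [ballot R n b] counts the ballot sequences with n steps up and b <= n down. *)
Definition ballot (R : pzRingType) (n b : nat) : R :=
  'C(n + b, b)%:R - (if b is c.+1 then 'C(n + b, c)%:R else 0).

Lemma ballotS (R : pzRingType) n b :
  ballot R n.+1 b.+1 = ballot R n b.+1 + ballot R n.+1 b.
Proof.
rewrite /ballot; case: b => [|b].
  by rewrite !addn1 addn0 !bin1 !bin0 subr0 -natr1 addrAC.
rewrite addSn binS natrD -[(n.+1 + b.+1)%N]addSnnS [(n + b.+2)%N]addnS addSn addnS.
by rewrite [X in _ - X%:R]binS natrD opprD addrACA.
Qed.

Lemma ballot_diag (R : pzRingType) n : ballot R n n.+1 = 0.
Proof.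
by rewrite /ballot -(bin_sub (leq_addr n.+1 n)) addKn subrr.
Qed.

(** Here [k] is the excess of up steps over down steps; in column 0, [ballot_diag] removes the
    sequences that would dip below zero. *)
Lemma is_ballot_ballot (R : pzRingType) :
  is_ballot 0 (fun n k => if (k <= n)%N then ballot R n (n - k) else 0).
Proof.
split=> [|n k|n|n k].
- by rewrite /ballot /= bin0 subr0.
- by rewrite ltnNge => /negbTE->.
- by rewrite /= subn0 subn1 /= mul0r add0r ballotS ballot_diag add0r.
rewrite !ltnS !subSS; case: (leqP k n) => [|nk]; last by rewrite ltnNge ltnW // addr0.
rewrite leq_eqVlt => /predU1P[->|kn].
  by rewrite subnn ltnn addr0 /ballot !addn0 !bin0.
by rewrite kn -(subnSK kn) ballotS.
Qed.

Lemma ballot_catalan (R : realType) n : ballot R n n = catalan R n.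
Proof.
rewrite /catalan /ballot addnn -mul2n; case: n => [|n].
  by rewrite muln0 !bin0 subr0 invr1 mulr1.
have n2 : n.+2%:R != 0 :> R by rewrite pnatr_eq0.
apply: (mulfI n2); rewrite mulVKf //.
have /(congr1 (fun m => m%:R : R)) := mul_bin_left (2 * n.+1) n.
have -> : (2 * n.+1 - n = n.+2)%N by lia.
by rewrite !natrM mulrBr => <-; rewrite -mulrBl -natrB // subSnn mul1r.
Qed.

(** * Convergence and closed form *)

Lemma psi_root (R : realType) (t : R) : 0 < `|t| < 1 / 4 ->
  0 <= psi t <= 2 /\ psi t - 1 = t * psi t ^+ 2.
Proof.
case/andP; rewrite normr_gt0 ltr_norml => t0 /andP[tl tr].
have s2 : Num.sqrt (1 - 4 * t) ^+ 2 = 1 - 4 * t by rewrite sqr_sqrtr //; lra.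
have s0 : 0 <= Num.sqrt (1 - 4 * t) by rewrite sqrtr_ge0.
rewrite /psi; move: (Num.sqrt _) s2 s0 => s s2 s0.
have s1 : 1 + s != 0 by rewrite gt_eqF //; lra.
(* Rationalised form, without division by [t]: [s >= 0] now gives both bounds. *)
have -> : (1 - s) / (2 * t) = 2 / (1 + s).
  apply/eqP; rewrite eqr_div ?mulf_neq0 ?pnatr_eq0 //; apply/eqP; ring: s2.
split.
  by rewrite divr_ge0 ?ler_pdivrMr ?addr_ge0 ?ltr_wpDr //=; lra.
have -> : t = (1 - s ^+ 2) / 4 by rewrite s2; lra.
by field.
Qed.

Lemma ballot_gf (R : realType) (y t : R) F : is_ballot y F ->
  0 < `|t| -> 2 * (4 + 2 * `|y|) * `|t| < 1 ->
  1 - y * psi t * t != 0 /\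
  pseries (fun n => F n 0%N) t @ \oo --> psi t / (1 - y * psi t * t).
Proof.
move=> Fb t0; set K := 4 + 2 * `|y| => Kt.
have y0 := normr_ge0 y.
have t4 : 8 * `|t| < 1 by rewrite /K in Kt; nra.
have [/andP[v0 v2] vE] := @psi_root R t ltac:(lra).
move: (psi t) v0 v2 vE => v v0 v2 vE.
have D0 : 1 - y * v * t != 0.
  rewrite subr_eq0 eq_sym; apply/eqP => /(congr1 Num.norm).
  rewrite !normrM (ger0_norm v0) normr1 => H.
  have := ler_wpM2r (mulr_ge0 y0 (ltW t0)) v2; rewrite /K in Kt; nra.
split=> //.
pose e n := F n 0%N * t ^+ n + v ^+ 2 * t ^+ n.+1 * \sum_(k < n.+1) F n k * v ^+ k.
have -> : pseries (fun n => F n 0%N) t = fun n => (v - e n) / (1 - y * v * t).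
  apply/funext => n; apply: (mulfI D0); rewrite mulrC [RHS]mulrC divfK // mulrC.
  by rewrite /e opprD addrA -(is_ballot_partial_sum n Fb vE).
suff e0 : e n @[n --> \oo] --> (0 : R).
  by rewrite -[X in X / _]subr0; apply: (cvgMr_tmp (cvgB (cvg_cst v) e0)).
apply: norm_cvg0.
have K0 : 0 <= K by rewrite /K; lra.
have q0 : 0 <= 2 * K * `|t| by rewrite !mulr_ge0 ?(ltW t0).
(* Each of the two terms of [e n] is at most (2K|t|)^n: in the row sum [v <= 2] cancels the weight
   [2 ^- k], and the number n+1 of terms is at most 2^n. *)
apply: (@squeeze_cvgr _ _ _ _ (fun=> 0) (geometric 2 (2 * K * `|t|))).
- near=> n; rewrite normr_ge0 /= /e (le_trans (ler_normD _ _)) //.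
  have P0 : 0 <= K ^+ n * `|t| ^+ n by rewrite mulr_ge0 ?exprn_ge0.
  have n2 : n.+1%:R <= 2 ^+ n :> R by rewrite -natrX ler_nat ltn_expl.
  have T1 : `|F n 0%N * t ^+ n| <= K ^+ n * `|t| ^+ n.
    rewrite normrM normrX ler_wpM2r ?exprn_ge0 //.
    by have := is_ballot_bound n 0 Fb; rewrite expr0 divr1.
  have T2 : `|\sum_(k < n.+1) F n k * v ^+ k| <= K ^+ n * n.+1%:R.
    rewrite (le_trans (ler_norm_sum _ _ _)) //.
    have -> : K ^+ n * n.+1%:R = \sum_(k < n.+1) K ^+ n.
      by rewrite sumr_const card_ord mulr_natr.
    apply: ler_sum => k _; rewrite normrM normrX (ger0_norm v0).
    have k2 : 0 < 2 ^+ k :> R by rewrite exprn_gt0.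
    have := is_ballot_bound n k Fb; rewrite -/K ler_pdivlMr //.
    by apply: le_trans; rewrite ler_wpM2l // lerXn2r ?nnegrE.
  have {T2}T2 : `|v ^+ 2 * t ^+ n.+1 * (\sum_(k < n.+1) F n k * v ^+ k)| <=
      K ^+ n * `|t| ^+ n * 2 ^+ n.
    rewrite normrM [`|v ^+ 2 * _|]normrM !normrX (ger0_norm v0) [`|t| ^+ n.+1]exprS.
    have v4 : v ^+ 2 * `|t| <= 1 by nra.
    have H : K ^+ n * n.+1%:R <= K ^+ n * 2 ^+ n by rewrite ler_wpM2l ?exprn_ge0.
    have {H}T2 := le_trans T2 H.
    have -> : K ^+ n * `|t| ^+ n * 2 ^+ n = 1 * `|t| ^+ n * (K ^+ n * 2 ^+ n) by ring.
    rewrite [v ^+ 2 * _]mulrA; apply: ler_pM => //.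
      by rewrite !mulr_ge0 ?exprn_ge0.
    by rewrite ler_wpM2r ?exprn_ge0.
  have -> : 2 * (2 * K * `|t|) ^+ n = 2 * (K ^+ n * `|t| ^+ n * 2 ^+ n).
    by rewrite !exprMn; ring.
  have : 1 <= 2 ^+ n :> R by rewrite exprn_ege1 // ler1n.
  move/(ler_wpM2l P0); lra.
- exact: cvg_cst.
- by apply: cvg_geometric; rewrite ger0_norm.
Unshelve. all: by end_near. Qed.

Lemma maclaurin_psi (R : realType) : maclaurin (@psi R) (@catalan R).
Proof.
exists (1 / 8); first lra.
move=> t /andP[t0 t8].
have [|] := ballot_gf (is_ballot_ballot R) t0; first by rewrite normr0; lra.
rewrite !mul0r subr0 divr1 => _.
suff -> : catalan R = fun n => if (0 <= n)%N then ballot R n (n - 0) else 0 by [].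
by apply/funext => n; rewrite leq0n subn0 ballot_catalan.
Qed.

Lemma maclaurin_gf (R : realType) (x : R) F : is_ballot (x - 1) F ->
  maclaurin (gf x) (fun n => F n 0%N).
Proof.
move=> Fb; pose K := 2 * (4 + 2 * `|x - 1|).
have K0 : 0 < K by rewrite /K; have := normr_ge0 (x - 1); lra.
(* Below [d] the denominator of [gf x t] is nonzero; at [x = 2] it is [t] itself. The [+ 1] guards
   against [x = 1]. *)
pose d := if x == 2 then 1 else `|2 - x| / ((x - 1) ^+ 2 + 1).
have S0 : 0 < (x - 1) ^+ 2 + 1 by rewrite ltr_wpDl // sqr_ge0.
have d0 : 0 < d.
  rewrite /d; case: eqVneq => // x2; by rewrite divr_gt0 // normr_gt0 subr_eq0 eq_sym.
exists (Num.min K^-1 d); first by rewrite lt_min invr_gt0 K0.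
move=> t /andP[t0]; rewrite lt_min => /andP[tK td].
have {tK}tK : K * `|t| < 1 by rewrite -ltr_pdivlMl // mulr1.
have [D0] := ballot_gf Fb t0 tK.
suff -> : gf x t = psi t / (1 - (x - 1) * psi t * t) by [].
have [|_ vE] := @psi_root R t.
  by rewrite t0 /=; have := normr_ge0 (x - 1); rewrite /K in tK; nra.
have N0 : 2 - x + t * (x - 1) ^+ 2 != 0.
  move: td; rewrite /d; case: eqVneq => [-> _|x2].
    by rewrite subrr add0r (_ : 2 - 1 = 1) ?expr1n ?mulr1 -?normr_gt0 //; lra.
  rewrite ltr_pdivlMr // => H; apply/eqP => /eqP; rewrite addr_eq0 => /eqP E.
  by move: H; rewrite E normrN normrM (ger0_norm (sqr_ge0 _)); nra.
(* With y = x - 1 and v = [psi t], it remains that (v - y)(1 - y v t) = v (1 - y + t y^2), from t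
   v^2 = v - 1. *)
rewrite /gf; apply/eqP; rewrite eqr_div //; apply/eqP.
ring: (esym vE).
Qed.

(** * Prepending a letter to a permutation *)

Lemma sum_lift_perm (V : nmodType) n (P : pred 'S_n.+1) (f : 'S_n.+1 -> V) :
  \sum_(s | P s) f s =
  \sum_(j < n.+1) \sum_(s : 'S_n | P (lift_perm ord0 j s)) f (lift_perm ord0 j s).
Proof.
rewrite (partition_big (fun s : 'S_n.+1 => s ord0) predT) //=.
apply: eq_bigr => j _; rewrite (reindex (lift_perm ord0 j)) /=.
  by apply: eq_bigl => s; rewrite lift_perm_id eqxx andbT.
(* [u s] is the word after the first letter, relabelled to skip the value [s ord0]; that value never
   recurs, so the default [k] is never taken. *)
pose u (s : 'S_n.+1) (k : 'I_n) := odflt k (unlift (s ord0) (s (lift ord0 k))).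
have uK (s : 'S_n.+1) (k : 'I_n) : lift (s ord0) (u s k) = s (lift ord0 k).
  rewrite /u; have := neq_lift ord0 k.
  by rewrite -(inj_eq (@perm_inj _ s)) => /unlift_some[? ? ->].
have u_inj (s : 'S_n.+1) : injective (u s).
  by move=> a b /(congr1 (lift (s ord0))); rewrite !uK => /perm_inj/lift_inj.
exists (fun s => perm (u_inj s)) => [s _|s /andP[_ /eqP s0]]; apply/permP => k.
  rewrite permE; apply: (@lift_inj _ j).
  by have := uK (lift_perm ord0 j s) k; rewrite lift_perm_id lift_perm_lift.
by case: (unliftP ord0 k) => [a|] ->; rewrite ?lift_perm_id // lift_perm_lift permE -s0 uK.
Qed.

Definition incr_below n k (s : 'S_n) : bool :=
  [forall a : 'I_n, forall b : 'I_n, (a < b)%N && (s a < k)%N ==> (s a < s b)%N].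

Lemma incr_belowP n k (s : 'S_n) :
  reflect (forall a b : 'I_n, (a < b)%N -> (s a < k)%N -> (s a < s b)%N)
    (incr_below k s).
Proof.
apply: (iffP forallP) => [H a b ab ak|H a].
  by have /forallP/(_ b) := H a; rewrite ab ak.
by apply/forallP => b; apply/implyP => /andP[]; apply: H.
Qed.

Lemma incr_below0 n (s : 'S_n) : incr_below 0 s.
Proof. exact/incr_belowP. Qed.

Lemma avoids321P n (s : 'S_n) :
  reflect (forall a b c : 'I_n, (a < b)%N -> (b < c)%N -> (s b < s a)%N -> (s b < s c)%N)
    (avoids321 s).
Proof.
apply: (iffP forallP) => [H a b c ab bc ba|H a].
  have /forallP/(_ b)/forallP/(_ c) := H a; rewrite ab bc ba /= -leqNgt leq_eqVlt.
  by case/orP=> // /eqP/val_inj/perm_inj E; rewrite E ltnn in bc.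
apply/forallP => b; apply/forallP => c; apply/negP => /and4P[ab bc ba].
by rewrite ltnNge ltnW // (H a).
Qed.

Lemma ltn_lift n (j : 'I_n.+1) (a b : 'I_n) : (lift j a < lift j b)%N = (a < b)%N.
Proof. by rewrite !ltnNge /= leq_bump2. Qed.

Lemma ltn_lift_l n (j : 'I_n.+1) (a : 'I_n) k :
  (k <= j)%N -> (lift j a < k)%N = (a < k)%N.
Proof. by rewrite /= /bump; lia. Qed.

(** A 321 pattern using the new first letter [j] is [j] followed by a descending pair of values
    below [j], which [incr_below j] forbids. *)
Lemma avoids321_lift n (j : 'I_n.+1) (s : 'S_n) :
  avoids321 (lift_perm ord0 j s) = avoids321 s && incr_below j s.
Proof.
apply/avoids321P/andP => [H|[/avoids321P H /incr_belowP I] a b c].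
  split; [apply/avoids321P => a b c ab bc ba | apply/incr_belowP => a b ab aj].
    by have := H (lift ord0 a) (lift ord0 b) (lift ord0 c);
      rewrite !lift_perm_lift !ltn_lift; apply.
  have := H ord0 (lift ord0 a) (lift ord0 b).
  by rewrite !lift_perm_lift lift_perm_id !ltn_lift ltn_lift_l //; apply; rewrite ?lift0.
case: (unliftP ord0 b) => [b' ->|-> //]; case: (unliftP ord0 c) => [c' ->|-> //].
rewrite !lift_perm_lift; case: (unliftP ord0 a) => [a' ->|-> _].
  by rewrite lift_perm_lift !ltn_lift; apply: H.
by rewrite lift_perm_id !ltn_lift ltn_lift_l //; apply: I.
Qed.

Lemma incr_below_lift0 n k (s : 'S_n) :
  incr_below k.+1 (lift_perm ord0 ord0 s) = incr_below k s.
Proof.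
apply/incr_belowP/incr_belowP => H a b.
  by have := H (lift ord0 a) (lift ord0 b); rewrite !lift_perm_lift !ltn_lift lift0 ltnS.
case: (unliftP ord0 b) => [b' ->|-> //]; rewrite lift_perm_lift.
case: (unliftP ord0 a) => [a' ->|->]; last by rewrite lift_perm_id lift0.
by rewrite lift_perm_lift !ltn_lift lift0 ltnS; apply: H.
Qed.

(** The value 0 stands after the first letter [j > 0], so [j] must not be below [k]; the other
    letters inherit their order from [s]. *)
Lemma incr_below_lift n k (j : 'I_n.+1) (s : 'S_n) : (0 < j)%N ->
  incr_below j s -> incr_below k (lift_perm ord0 j s) = (k <= j)%N.
Proof.
move=> j0 /incr_belowP I; apply/incr_belowP/idP => [H|kj a b].
  rewrite leqNgt; apply/negP => jk.
  have := H ord0 ((lift_perm ord0 j s)^-1%g ord0).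
  rewrite permKV lift_perm_id /= ltn0 jk => /(_ _ isT) F.
  suff /F : (0 < (lift_perm ord0 j s)^-1%g ord0)%N by [].
  rewrite lt0n; apply/eqP => E0.
  have /(congr1 (lift_perm ord0 j s)) : (lift_perm ord0 j s)^-1%g ord0 = ord0 by exact: val_inj.
  by rewrite permKV lift_perm_id => E; rewrite -E in j0.
case: (unliftP ord0 b) => [b' ->|-> //]; rewrite lift_perm_lift.
case: (unliftP ord0 a) => [a' ->|->]; last by rewrite lift_perm_id; lia.
rewrite lift_perm_lift !ltn_lift ltn_lift_l // => ab ak.
by apply: I => //; apply: leq_trans kj.
Qed.

(* If s a < j, the values 0, ..., s a occur in this order, so the position of
   s a is at least s a. *)
Lemma incr_below_ge n j (s : 'S_n) (a : 'I_n) :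
  incr_below j s -> (s a < j)%N -> (s a <= a)%N.
Proof.
move/incr_belowP => I; have [v] := ubnP (s a).
elim: v a => // v IHv a; rewrite ltnS => av aj.
case E : (s a : nat) => [//|m].
have mn : (m < n)%N by have := ltn_ord (s a); lia.
pose b := (s^-1)%g (Ordinal mn).
have sb : s b = m :> nat by rewrite permKV.
have mb : (m <= b)%N by rewrite -sb; apply: IHv; lia.
have [ab|ba|/val_inj ab] := ltngtP a b; last by rewrite -ab in sb; lia.
  by have := I _ _ ab aj; lia.
by lia.
Qed.

Definition fix_from n k (s : 'S_n) : nat :=
  #|[set i : 'I_n | (k <= i)%N && (s i == i)]%SET|.

(* The letter j put in front shifts every position by one, but only the values
   >= j: by [incr_below_ge] no letter below j can become a fixed point. *)
Lemma fix_from_lift n k (j : 'I_n.+1) (s : 'S_n) : (0 < j)%N -> (k <= j)%N ->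
  incr_below j s -> fix_from k (lift_perm ord0 j s) = fix_from j s.
Proof.
move=> j0 kj I; rewrite /fix_from -[RHS](card_imset _ (@lift_inj _ ord0)).
apply: eq_card => i; rewrite inE; case: (unliftP ord0 i) => [a ->|->].
  rewrite mem_imset; last exact: lift_inj.
  rewrite inE lift_perm_lift -val_eqE /= /bump /=.
  have [ja|aj] := leqP j (s a).
    rewrite !add1n eqSS val_eqE; case: eqP => [E|_]; last by rewrite !andbF.
    by rewrite -[in RHS]E ja (leq_trans kj) // leqW // -E.
  have sa := incr_below_ge I aj; rewrite add0n add1n ltn_eqF ?ltnS // andbF.
  by case: eqP => [E|_]; rewrite ?andbF // -E leqNgt aj.
rewrite lift_perm_id -val_eqE /= [(j == 0 :> nat)%N]gtn_eqF // andbF.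
by apply/esym/imsetP => -[a _ /eqP]; rewrite (negbTE (neq_lift _ _)).
Qed.

Lemma fix_from_lift0 n k (s : 'S_n) :
  fix_from k.+1 (lift_perm ord0 ord0 s) = fix_from k s.
Proof.
rewrite /fix_from -[RHS](card_imset _ (@lift_inj _ ord0)).
apply: eq_card => i; rewrite inE; case: (unliftP ord0 i) => [a ->|->].
  rewrite mem_imset; last exact: lift_inj.
  by rewrite inE lift_perm_lift (inj_eq lift_inj) lift0 ltnS.
by apply/esym/imsetP => -[a _ /eqP]; rewrite (negbTE (neq_lift _ _)).
Qed.

Lemma fix_from0_lift0 n (s : 'S_n) :
  fix_from 0 (lift_perm ord0 ord0 s) = (fix_from 0 s).+1.
Proof.
rewrite -(fix_from_lift0 0 s) {1}/fix_from (cardsD1 ord0) inE lift_perm_id eqxx add1n.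
by congr _.+1; apply: eq_card => i; rewrite !inE lt0n.
Qed.

(** * Recursion for the permutation sums *)

(* For k > n the condition [incr_below k] would not make the sum empty; the
   value 0 is what the recursion needs. *)
Definition perm_sum (R : pzSemiRingType) (x : R) n k : R :=
  if (k <= n)%N then \sum_(s : 'S_n | avoids321 s && incr_below k s) x ^+ fix_from k s
  else 0.

Lemma perm_sum_lift (R : pzSemiRingType) (x : R) n k (j : 'I_n) :
  \sum_(s : 'S_n | avoids321 (lift_perm ord0 (lift ord0 j) s) &&
                    incr_below k (lift_perm ord0 (lift ord0 j) s))
     x ^+ fix_from k (lift_perm ord0 (lift ord0 j) s) =
  if (k <= j.+1)%N then perm_sum x n j.+1 else 0.
Proof.
rewrite /perm_sum ltn_ord.
have eq_cond (s : 'S_n) : avoids321 (lift_perm ord0 (lift ord0 j) s) &&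
    incr_below k (lift_perm ord0 (lift ord0 j) s) =
    [&& avoids321 s, incr_below j.+1 s & (k <= j.+1)%N].
  rewrite avoids321_lift -andbA; congr (_ && _).
  by apply: andb_id2l => I; rewrite incr_below_lift.
case: ifP => kj; last by rewrite big_pred0 // => s; rewrite eq_cond kj !andbF.
apply: eq_big => s; first by rewrite eq_cond kj andbT.
by rewrite eq_cond => /and3P[_ I _]; rewrite fix_from_lift.
Qed.

Lemma perm_sum00 (R : pzSemiRingType) (x : R) : perm_sum x 0 0 = 1.
Proof.
have E (s : 'S_0) : s = 1%g by apply/permP => -[].
rewrite /perm_sum (big_pred1 (1%g : 'S_0)) => [|s].
  by rewrite /fix_from eq_card0 ?expr0 // => -[].
rewrite [RHS](introT eqP (E s)); apply/andP; split; last exact: incr_below0.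
by apply/avoids321P => -[].
Qed.

Lemma perm_sumS0 (R : pzSemiRingType) (x : R) n :
  perm_sum x n.+1 0 = x * perm_sum x n 0 + \sum_(j < n) perm_sum x n j.+1.
Proof.
rewrite {1}/perm_sum leq0n sum_lift_perm big_ord_recl; congr (_ + _).
  rewrite /perm_sum leq0n mulr_sumr; apply: eq_big => [s|s _].
    by rewrite avoids321_lift /= !incr_below0 andbT.
  by rewrite fix_from0_lift0 exprS.
by apply: eq_bigr => j _; rewrite perm_sum_lift.
Qed.

(** A leading 0 is a fixed point below the threshold [k.+1], so it brings no factor [x], unlike in
    [perm_sumS0]. *)
Lemma perm_sumSS (R : pzSemiRingType) (x : R) n k : (k <= n)%N ->
  perm_sum x n.+1 k.+1 = perm_sum x n k + \sum_(j < n | (k <= j)%N) perm_sum x n j.+1.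
Proof.
move=> kn; rewrite {1}/perm_sum ltnS kn sum_lift_perm big_ord_recl; congr (_ + _).
  rewrite /perm_sum kn; apply: eq_big => [s|s _]; last by rewrite fix_from_lift0.
  rewrite avoids321_lift incr_below_lift0 -andbA; congr (_ && _).
  by rewrite incr_below0.
rewrite [RHS]big_mkcond; apply: eq_bigr => j _; exact: perm_sum_lift.
Qed.

Lemma is_ballot_perm_sum (R : pzRingType) (x : R) :
  is_ballot (x - 1) (perm_sum x).
Proof.
have gt n k : (n < k)%N -> perm_sum x n k = 0.
  by rewrite /perm_sum ltnNge => /negbTE->.
split=> [|//|n|n k].
- exact: perm_sum00.
(* Columns 0 and 1 differ only in the coefficient of [perm_sum x n 0]: [x] against 1. *)
- by rewrite perm_sumS0 perm_sumSS // mulrBl mul1r addrA subrK.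
have [nk|kn|->] := ltngtP n k.
- by rewrite !gt ?addr0 // ltnS ltnW.
(* The term [j = k] split off here is the leading term of [perm_sum x n.+1 k.+2]. *)
- rewrite !perm_sumSS ?(ltnW kn) // (bigD1 (Ordinal kn)) //=; congr (_ + (_ + _)).
  by apply: eq_bigl => j; rewrite ltn_neqAle eq_sym andbC.
- by rewrite perm_sumSS // [perm_sum x k.+1 _]gt // big_pred0 // => j; rewrite leqNgt ltn_ord.
Qed.

Lemma horner_A (R : realType) (x : R) n : (A R n).[x] = perm_sum x n 0.
Proof.
rewrite /A /perm_sum leq0n horner_sum; apply: eq_big => [s|s _].
  by rewrite incr_below0 andbT.
by rewrite hornerXn.
Qed.

Theorem theorem4p1 (R : realType) :
  maclaurin (@psi R) (@catalan R) /\
  forall x : R, exists2 a : nat -> R,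
    maclaurin (gf x) a & forall n : nat, (A R n).[x] = a n.
Proof.
split=> [|x]; first exact: maclaurin_psi.
exists (fun n => perm_sum x n 0); first exact: maclaurin_gf (is_ballot_perm_sum x).
exact: horner_A.
Qed.
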